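(* Let $n \equiv 3 \pmod 4$ be a strong pseudoprime to base $2$. Let $k \ge 0$ be an integer, and set $P = 2^k$ and $Q = 2^{2k-1}$ (for $k = 0$, $Q$ is interpreted as the inverse of $2$ modulo $n$, i.e. $Q \equiv (n+1)/2 \pmod n$). Then $n$ is a strong Lucas pseudoprime with parameters $(P, Q)$ and a Lucas-V pseudoprime with parameters $(P, Q)$.
   Context: For an odd integer $n>1$ write $n - 1 = d \cdot 2^s$ with $d$ odd. A composite $n$ is a strong pseudoprime to base $a$ if $a^d \equiv 1 \pmod n$ or $a^{d\cdot 2^r} \equiv -1 \pmod n$ for some $0 \le r < s$. Given $P, Q$ (here regarded as elements of $\mathbb{Z}/n\mathbb{Z}$), the Lucas sequences are $U_0 = 0$, $U_1 = 1$, $V_0 = 2$, $V_1 = P$, $U_j = PU_{j-1} - QU_{j-2}$, $V_j = PV_{j-1} - QV_{j-2}$ for $j \ge 2$, computed modulo $n$; set $D = P^2 - 4Q$. Write $n + 1 = d' \cdot 2^{s'}$ with $d'$ odd. A composite odd $n$ is a strong Lucas pseudoprime with parameters $(P,Q)$ if the Jacobi symbol $(D/n) = -1$ and either $U_{d'} \equiv 0 \pmod n$ or $V_{d' \cdot 2^r} \equiv 0 \pmod n$ for some $0 \le r < s'$. A composite odd $n$ is a Lucas-V pseudoprime with parameters $(P,Q)$ if $V_{n+1} \equiv 2Q \pmod n$. *)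

(* Defs.v *)
From HB Require Import structures.
From mathcomp Require Import all_boot all_order all_algebra.

Set Implicit Arguments.
Unset Strict Implicit.
Unset Printing Implicit Defensive.

Import Order.TTheory GRing.Theory Num.Theory.
Local Open Scope ring_scope.

(* 'Z_n and 'F_p are Z/nZ and Z/pZ only for 1 < n and p prime; below they are
   only relevant under these conditions. *)

Definition odd_composite (n : nat) : bool := [&& (1 < n)%N, odd n & ~~ prime n].

Definition legendre (a : int) (p : nat) : int :=
  if a%:~R == 0 :> 'F_p then 0
  else if [exists x : 'F_p, x ^+ 2 == a%:~R] then 1 else -1.

Definition jacobi (a : int) (n : nat) : int :=
  \prod_(f <- prime_decomp n) legendre a f.1 ^+ f.2.

(* The symbol of a class modulo n, computed on its representative in [0, n);
   the Jacobi symbol does not depend on the representative. *)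
Definition jacobi_class (n : nat) (a : 'Z_n) : int := jacobi (a : nat)%:Z n.
Arguments jacobi_class : clear implicits.

Fixpoint lucasU (R : nzRingType) (P Q : R) (j : nat) : R :=
  match j with
  | 0 => 0
  | 1 => 1
  | (i.+1 as i1).+1 => P * lucasU P Q i1 - Q * lucasU P Q i
  end.

Fixpoint lucasV (R : nzRingType) (P Q : R) (j : nat) : R :=
  match j with
  | 0 => 2
  | 1 => P
  | (i.+1 as i1).+1 => P * lucasV P Q i1 - Q * lucasV P Q i
  end.

Definition lucas_disc (R : nzRingType) (P Q : R) : R := P ^+ 2 - 4 * Q.

(* The pair (d, s) is unique, since n - 1 <> 0. *)
Definition strong_pseudoprime (n : nat) (a : 'Z_n) : Prop :=
  odd_composite n /\
  exists d s : nat,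
    [/\ odd d, (n - 1 = d * 2 ^ s)%N &
      a ^+ d = 1 \/ exists2 r : nat, (r < s)%N & a ^+ (d * 2 ^ r) = -1].
Arguments strong_pseudoprime : clear implicits.

Definition strong_lucas_pseudoprime (n : nat) (P Q : 'Z_n) : Prop :=
  [/\ odd_composite n, jacobi_class n (lucas_disc P Q) = -1 &
    exists d s : nat,
      [/\ odd d, (n + 1 = d * 2 ^ s)%N &
        lucasU P Q d = 0 \/
        exists2 r : nat, (r < s)%N & lucasV P Q (d * 2 ^ r) = 0]].
Arguments strong_lucas_pseudoprime : clear implicits.

Definition lucasV_pseudoprime (n : nat) (P Q : 'Z_n) : Prop :=
  odd_composite n /\ lucasV P Q (n + 1) = 2 * Q.
Arguments lucasV_pseudoprime : clear implicits.

(* Main.v *)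
(* Since P ^ 2 = 2 Q, the discriminant is - P ^ 2, and its Jacobi symbol is
   (-1 / n) = -1. The same relation gives V_2 = 0 and V_{j+4} = - Q ^ 2 V_j, so V
   vanishes at every index congruent to 2 modulo 4, in particular at 2 d', while
   V_{n+1} = 2 (-1) ^ ((n+1)/4) Q ^ ((n+1)/2). As 2 Q is a square, Q ^ ((n-1)/2)
   is the inverse of 2 ^ ((n-1)/2), which is a sign by hypothesis. That sign is
   (-1) ^ ((n+1)/4): it makes 2 or -2 a square modulo each prime factor of n, so
   the second supplement to quadratic reciprocity determines n modulo 8. *)
Require Import Defs.
From HB Require Import structures.
From mathcomp Require Import all_boot all_order all_algebra.
From mathcomp Require Import finfield closed_field.
From mathcomp Require Import zify ring.

Set Implicit Arguments.
Unset Strict Implicit.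
Unset Printing Implicit Defensive.

Import Order.TTheory GRing.Theory Num.Theory.
Local Open Scope ring_scope.

(** * Powers of 2 modulo an odd prime *)

Lemma pchar_odd_neq0 (R : idomainType) (p : nat) :
  p \in [pchar R] -> odd p -> (-1 != 1 :> R) && (2 != 0 :> R).
Proof.
move=> pR op; have p2 : 2 != 0 :> R.
  rewrite -(dvdn_pcharf pR) dvdn_prime2 ?(pcharf_prime pR) //.
  by apply/eqP => p2; rewrite p2 in op.
by rewrite p2 andbT -subr_eq0 -opprD oppr_eq0.
Qed.

Lemma signr_eq_odd (R : idomainType) (p m n : nat) :
  p \in [pchar R] -> odd p -> (-1) ^+ m = (-1) ^+ n :> R -> odd m = odd n.
Proof.
move=> pR op; have /andP[/negPf n1 _] := pchar_odd_neq0 pR op.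
rewrite -signr_odd -[RHS]signr_odd; case: odd; case: odd => //= /eqP.
  by rewrite expr0 expr1 n1.
by rewrite expr0 expr1 eq_sym n1.
Qed.

(* In Z[i] modulo p, compare (1 + i) ^ p = 1 + i ^ p with (1 + i) ^ 2 = 2 i. *)
Lemma two_expr_half_sqrtN1 (K : fieldType) (p : nat) (i : K) :
  p \in [pchar K] -> odd p -> i ^+ 2 = -1 ->
  2 ^+ p./2 = (-1) ^+ uphalf p./2 :> K.
Proof.
move=> pK op i2; have /andP[_ two0] := pchar_odd_neq0 pK op.
have pE : p = (p./2).*2.+1 by rewrite -[LHS]odd_double_half op.
have := pFrobenius_autD_comm pK (mulrC 1 i).
rewrite !pFrobenius_autE expr1n; move: p./2 pE => h ->.
have sq : (1 + i) ^+ 2 = 2 * i by rewrite sqrrD i2; ring.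
have hE : h = (odd h + (h./2).*2)%N by rewrite odd_double_half.
rewrite !exprSr -muln2 mulnC !exprM sq i2 exprMn => e.
(* Multiplying by [1 - i] turns the factor [1 + i] into 2, while the other side,
   [(1 - i) * (1 + (-1) ^+ h * i)], becomes 2 or - 2 i according to the parity of [h]. *)
apply: (mulfI two0); move/(congr1 (fun x => (1 - i) * x)): e.
have -> : (1 - i) * (2 ^+ h * i ^+ h * (1 + i)) = 2 * (2 ^+ h * i ^+ h).
  rewrite (_ : _ * _ = (1 - i ^+ 2) * (2 ^+ h * i ^+ h)); last by ring.
  by rewrite i2; ring.
have -> : i ^+ h = i ^+ odd h * (-1) ^+ h./2.
  by rewrite [X in i ^+ X]hE exprD -muln2 mulnC exprM i2.
rewrite uphalf_half exprD -[(-1) ^+ h]signr_odd.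
have s2 : (-1) ^+ h./2 * (-1) ^+ h./2 = 1 :> K by rewrite -expr2 sqrr_sign.
have s0 : (-1) ^+ h./2 != 0 :> K by rewrite signr_eq0.
have i0 : i != 0 by rewrite -sqrf_eq0 i2 oppr_eq0 oner_eq0.
case: odd; rewrite ?expr1 ?expr0 => e.
  apply: (mulIf i0); apply: (mulIf s0).
  transitivity (2 * (2 ^+ h * (i * (-1) ^+ h./2))); first by ring.
  rewrite e (_ : _ * _ = 1 - i + - i + i ^+ 2); last by ring.
  rewrite i2 [RHS](_ : _ = - 2 * i * ((-1) ^+ h./2 * (-1) ^+ h./2)).
    by rewrite s2; ring.
  by ring.
apply: (mulIf s0).
transitivity (2 * (2 ^+ h * (1 * (-1) ^+ h./2)) : K); first by ring.
rewrite e (_ : _ * _ = 1 - i ^+ 2); last by ring.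
rewrite i2 [RHS](_ : _ = 2 * ((-1) ^+ h./2 * (-1) ^+ h./2)); last by ring.
by rewrite s2; ring.
Qed.

(** A square root of -1 may be missing from 'F_p, so the computation is done in an algebraic closure
    and pulled back along the injective embedding [f]. *)
Lemma two_expr_half (p : nat) :
  prime p -> odd p -> 2 ^+ p./2 = (-1) ^+ uphalf p./2 :> 'F_p.
Proof.
move=> pp op.
have [K [f _]] := countable_algebraic_closure 'F_p.
have [i i2] : exists i : K, i ^+ 2 = -1.
  have [x] := solve_monicpoly
    (fun j => if j == 0%N then -1 else 0 : K) (n := 2) isT.
  by rewrite !big_ord_recl big_ord0 /= expr0 mul0r mulr1 !addr0; exists x.
have pK : p \in [pchar K] by rewrite (fmorph_pchar f) pchar_Fp.
apply: (fmorph_inj f); rewrite !rmorphXn /= rmorphN rmorph1 rmorph_nat.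
exact: two_expr_half_sqrtN1 i2.
Qed.

(** * The symbol of minus a square *)

Lemma Fp_expr_pred (p : nat) (x : 'F_p) : prime p -> x != 0 -> x ^+ p.-1 = 1.
Proof.
move=> pp x0; apply: (mulfI x0); rewrite -exprS prednK ?prime_gt0 // mulr1.
by have := expf_card x; rewrite card_Fp.
Qed.

Lemma odd_pred_half (p : nat) : odd p -> p.-1 = (2 * p./2)%N.
Proof. lia. Qed.

(** With h = [p./2], the polynomial X^h - 1 has too few roots to vanish at all 2h nonzero classes.
    Some nonzero x thus has x^h = -1, and h is even. *)
Lemma Fp_sqrtN1 (p : nat) : prime p -> odd p -> ~~ odd p./2 ->
  exists x : 'F_p, x ^+ 2 = -1.
Proof.
move=> pp op eh.
have h0 : (0 < p./2)%N by have := prime_gt1 pp; lia.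
have [x /andP[x0 xh]] : exists x : 'F_p, (x != 0) && (x ^+ p./2 != 1).
  apply/existsP; apply: contraT => /existsPn nox.
  have := @max_poly_roots _ ('X^(p./2) - 1%:P : {poly 'F_p})
    (enum (predC1 (0 : 'F_p))).
  rewrite -size_poly_eq0 size_XnsubC // enum_uniq -cardE => /(_ isT) H.
  have := cardC1 (0 : 'F_p); rewrite card_Fp // => c.
  suff : (p.-1 < (p./2).+1)%N by rewrite odd_pred_half //; lia.
  rewrite -c; apply: H => //; apply/allP => x; rewrite mem_enum inE => x0.
  have := nox x; rewrite x0 negbK => /eqP xh.
  by rewrite rootE !hornerE xh subrr.
have /eqP : (x ^+ p./2) ^+ 2 = 1.
  by rewrite -exprM mulnC -odd_pred_half // Fp_expr_pred.
rewrite sqrf_eq1 (negPf xh) /= => /eqP xhN.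
by exists (x ^+ (p./2)./2); rewrite -exprM -xhN; congr (_ ^+ _); lia.
Qed.

(** Dividing by c ^ 2 reduces the question to whether -1 is a square. If it is, Fermat's little
    theorem forces [p./2] to be even; [Fp_sqrtN1] is the converse. *)
Lemma legendre_opp_sqr (p : nat) (a : int) (c : 'F_p) :
  prime p -> odd p -> c != 0 -> a%:~R = - c ^+ 2 ->
  legendre a p = (-1) ^+ p./2.
Proof.
move=> pp op c0 ac; rewrite /legendre ac oppr_eq0 sqrf_eq0 (negPf c0).
rewrite -signr_odd; case: ifPn => [/existsP[x /eqP xE] | /existsPn nox].
  have : (x / c) ^+ 2 = -1.
    by rewrite expr_div_n xE mulNr divff ?sqrf_eq0.
  have y0 : x / c != 0.
    rewrite mulf_neq0 ?invr_neq0 // -sqrf_eq0 xE oppr_eq0 sqrf_eq0 //.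
  have := Fp_expr_pred pp y0; rewrite odd_pred_half // exprM => + yE.
  by rewrite yE => /(signr_eq_odd (n := 0) (pchar_Fp pp) op) ->.
case: (boolP (odd p./2)) => // /(Fp_sqrtN1 pp op)[x xE].
by have := nox (x * c); rewrite exprMn xE mulN1r eqxx.
Qed.

(* (-1) ^+ x./2 is the nontrivial character modulo 4. *)
Lemma signr_half_mul (x y : nat) : odd x -> odd y ->
  (-1) ^+ (x * y)./2 = (-1) ^+ x./2 * (-1) ^+ y./2 :> int.
Proof.
move=> ox oy; rewrite -exprD -signr_odd -[RHS]signr_odd; congr (_ ^+ _).
congr nat_of_bool.
have -> : (x * y)./2 = (x./2 + y./2 + (x./2 * y./2).*2)%N.
  rewrite -[x in LHS]odd_double_half -[y in LHS]odd_double_half ox oy.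
  by move: x./2 y./2 => u v; nia.
by rewrite oddD odd_double addbF.
Qed.

Lemma jacobi_opp_sqr (n : nat) (a : int) (c : nat) :
  odd n -> coprime n c -> (n %| a + c%:Z ^+ 2)%Z ->
  jacobi a n = (-1) ^+ n./2.
Proof.
move=> on cop dvd; have n0 : (0 < n)%N by case: n on {cop dvd}.
have good f : f \in prime_decomp n ->
    odd f.1 /\ legendre a f.1 = (-1) ^+ (f.1)./2.
  case: f => p e /mem_prime_decomp[pp e0 pn] /=.
  have {}pn : (p %| n)%N by apply: dvdn_trans pn; rewrite dvdn_exp.
  have op : odd p by apply: dvdn_odd on.
  have c0 : c%:R != 0 :> 'F_p.
    rewrite -(dvdn_pcharf (pchar_Fp pp)) -prime_coprime //.
    exact: coprime_dvdl cop.
  split=> //; apply: (legendre_opp_sqr pp op c0).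
  apply/eqP; rewrite -addr_eq0; apply/eqP.
  have {}dvd : (p %| a + c%:Z ^+ 2)%Z by apply: dvdz_trans dvd; rewrite dvdzE.
  case/dvdzP: dvd => q /(congr1 (fun z => z%:~R : 'F_p)).
  by rewrite rmorphD rmorphXn rmorphM /= -!pmulrn (pchar_Fp_0 pp) mulr0.
have -> : jacobi a n = \prod_(f <- prime_decomp n) ((-1) ^+ (f.1)./2) ^+ f.2.
  by apply: eq_big_seq => f /good[_ ->].
rewrite [in RHS](prod_prime_decomp n0).
(* Oddness of the partial products is carried through the induction because [signr_half_mul] needs
   it. *)
suff [] : odd (\prod_(f <- prime_decomp n) f.1 ^ f.2) /\
   \prod_(f <- prime_decomp n) ((-1) ^+ (f.1)./2) ^+ f.2 =
   (-1) ^+ (\prod_(f <- prime_decomp n) f.1 ^ f.2)./2 :> int by [].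
elim: (prime_decomp n) good => [|f r IHr] good; first by rewrite !big_nil.
have [o _] := good f (mem_head f r).
have [g gr|odd_r Er] := IHr; first by apply: good; rewrite in_cons gr orbT.
rewrite !big_cons Er oddM oddX o orbT odd_r; split => //.
rewrite signr_half_mul ?oddX ?o ?orbT //; congr (_ * _).
elim: f.2 => //= e IHe.
by rewrite exprS IHe expnS signr_half_mul // oddX o orbT.
Qed.

(** * The class of n modulo 8 *)

Lemma Zp_intr_eq0 (n : nat) (z : int) :
  (1 < n)%N -> (z%:~R == 0 :> 'Z_n) = (n %| z)%Z.
Proof.
move=> n1; have nat0 m : (m%:R == 0 :> 'Z_n) = (n %| m)%N.
  by rewrite -(inj_eq val_inj) /= val_Zp_nat.
by case: (intP z) => [|m|m];
  rewrite ?rmorphN /= ?oppr_eq0 ?dvdzN -?pmulrn ?nat0 ?dvdzE.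
Qed.

(* The sign (-1) ^+ e times 2 is a square modulo every prime p %| n, because
   n./2 is odd; this confines p, hence n, to two classes modulo 8. *)
Lemma two_pow_half_mod8 (n : nat) (e : bool) :
  (n = 3 %[mod 4])%N -> (n %| 2%:Z ^+ n./2 - (-1) ^+ e)%Z ->
  e = odd (n.+1 %/ 4).
Proof.
move=> n3 dvd.
have n0 : (0 < n)%N by lia.
(* These are the classes of the primes modulo which -2 (if [e]) or 2 (otherwise) is a square. Each
   pair is closed under multiplication and has one member that is 3 modulo 4. *)
pose S m := ((m %% 8 == 1) || (m %% 8 == if e then 3 else 7))%N.
have good f : f \in prime_decomp n -> S f.1.
  case: f => p k /mem_prime_decomp[pp k0 pn] /=.
  have {}pn : (p %| n)%N by apply: dvdn_trans pn; rewrite dvdn_exp.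
  have op : odd p by apply: dvdn_odd pn _; lia.
  have {}dvd : (p %| 2%:Z ^+ n./2 - (-1) ^+ e)%Z.
    by apply: dvdz_trans dvd; rewrite dvdzE.
  have /eqP : 2 ^+ n./2 - (-1) ^+ e = 0 :> 'F_p.
    case/dvdzP: dvd => q /(congr1 (fun z => z%:~R : 'F_p)).
    rewrite rmorphB !rmorphXn rmorphM /= rmorphN rmorph1 => ->.
    by rewrite -pmulrn (pchar_Fp_0 pp) mulr0.
  (* After raising to the power [p./2], both sides are signs; comparing the parities of their
     exponents, with [n./2] odd, fixes p modulo 8. *)
  rewrite subr_eq0 => /eqP /(congr1 (fun x => x ^+ p./2)).
  rewrite -exprM mulnC exprM two_expr_half // -!exprM.
  move=> /(signr_eq_odd (pchar_Fp pp) op); rewrite !oddM /S.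
  by case: e {S dvd}; lia.
suff : S n by rewrite /S; case: e {dvd S good}; lia.
rewrite (prod_prime_decomp n0) big_seq.
have SM x y : S x -> S y -> S (x * y)%N.
  by rewrite /S -modnMm; case: e {dvd S good}; do 2!case/orP => /eqP ->.
apply: (big_ind S) => //= f /good Sf.
by elim: f.2 => // k IH; rewrite expnS SM.
Qed.

(** * The sequence V when P ^ 2 = 2 Q *)

Lemma lucasVSS (R : nzRingType) (P Q : R) (j : nat) :
  lucasV P Q j.+2 = P * lucasV P Q j.+1 - Q * lucasV P Q j.
Proof. by []. Qed.

Lemma lucasV_add4 (R : comNzRingType) (P Q : R) (j : nat) :
  P ^+ 2 = 2 * Q ->
  lucasV P Q (j + 4) = - Q ^+ 2 * lucasV P Q j.
Proof.
move=> PQ; rewrite !addnS addn0 !lucasVSS.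
move: (lucasV P Q j.+1) (lucasV P Q j) => v u.
have -> : P * (P * (P * v - Q * u) - Q * v) - Q * (P * v - Q * u) =
  P ^+ 2 * (P * v - Q * u) - 2 * Q * (P * v) + Q ^+ 2 * u by ring.
by rewrite PQ; ring.
Qed.

Lemma lucasV_mul4 (R : comNzRingType) (P Q : R) (m : nat) :
  P ^+ 2 = 2 * Q ->
  lucasV P Q (4 * m) = 2 * (-1) ^+ m * Q ^+ (2 * m).
Proof.
move=> PQ; elim: m => [|m IH]; first by rewrite !muln0 !expr0 !mulr1.
by rewrite !mulnS addnC lucasV_add4 // IH exprD (exprS (-1)); ring.
Qed.

Lemma lucasV_mul4_add2 (R : comNzRingType) (P Q : R) (m : nat) :
  P ^+ 2 = 2 * Q -> lucasV P Q (4 * m + 2) = 0.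
Proof.
move=> PQ.
elim: m => [|m IH]; last by rewrite mulnS -addnA addnC lucasV_add4 // IH mulr0.
by rewrite muln0 /= -expr2 PQ mulrC subrr.
Qed.

Theorem theorem1 (n k : nat) (hn : (n = 3 %[mod 4])%N)
    (hpsp : strong_pseudoprime n (2 : 'Z_n)) :
  let P : 'Z_n := 2 ^+ k in
  let Q : 'Z_n := if k == 0%N then 2^-1 else 2 ^+ (2 * k - 1) in
  strong_lucas_pseudoprime n P Q /\ lucasV_pseudoprime n P Q.
Proof.
move=> P Q; case: hpsp => comp [d [s [od nE pow2]]].
have /and3P[n1 on _] := comp.
have copn m : coprime n (2 ^ m) by rewrite coprimeXr // coprimen2.
have u2 : (2 : 'Z_n) \is a GRing.unit by rewrite unitZpE // coprimen2.
have PQ : P ^+ 2 = 2 * Q.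
  rewrite /P /Q; case: eqP => [->|/eqP k0]; first by rewrite expr0 expr1n divrr.
  by rewrite -exprM -exprS; congr (_ ^+ _); lia.
(* Since n - 1 is 2 modulo 4, d is [n./2] and only r = 0 can occur, so either alternative makes 2 ^
   [n./2] a sign. *)
have s1 : s = 1%N.
  case: s nE {pow2} => [|[|s]] //; first by rewrite expn0; lia.
  by rewrite !expnS; lia.
have [e he] : exists e : bool, (2 : 'Z_n) ^+ n./2 = (-1) ^+ e.
  have -> : n./2 = d by move: nE; rewrite s1; lia.
  case: pow2 => [->|[r]]; first by exists false.
  by rewrite s1 ltnS leqn0 => /eqP ->; rewrite muln1 => ->; exists true.
have [m mE] : exists m, (n + 1 = 4 * m)%N by exists (n.+1 %/ 4)%N; lia.
have em : e = odd m.
  have -> : m = (n.+1 %/ 4)%N by lia.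
  apply: two_pow_half_mod8 => //; rewrite -Zp_intr_eq0 //.
  by rewrite rmorphB !rmorphXn /= rmorphN rmorph1 he subrr.
have VQ : lucasV P Q (n + 1) = 2 * Q.
  rewrite mE lucasV_mul4 //.
  have -> : (2 * m = n./2.+1)%N by lia.
  (* Here 2 Q = 2 ^ (2 k), so the product is a power of 2 ^ (n - 1), the square of a sign. *)
  have : 2 ^+ n./2 * Q ^+ n./2 = 1.
    rewrite -exprMn -PQ /P -!exprM.
    have -> : (k * 2 * n./2 = n./2 * 2 * k)%N by lia.
    by rewrite exprM [2 ^+ (n./2 * 2)]exprM he sqrr_sign expr1n.
  move=> /(congr1 (fun x => (-1) ^+ e * x)).
  rewrite he mulrA -expr2 sqrr_sign mul1r mulr1 => Qh.
  rewrite exprS Qh em signr_odd.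
  transitivity (2 * Q * ((-1) ^+ m * (-1) ^+ m)); first by ring.
  by rewrite -expr2 sqrr_sign mulr1.
have jac : jacobi_class n (lucas_disc P Q) = -1.
  have : lucas_disc P Q = - P ^+ 2 by rewrite /lucas_disc PQ; ring.
  rewrite /jacobi_class; move: (lucas_disc P Q) => D DE.
  (* The witness is P lifted to a natural number; it is coprime to n because n is odd. *)
  rewrite (jacobi_opp_sqr (c := 2 ^ k)) //.
    by rewrite -signr_odd (_ : odd n./2 = true) //; lia.
  rewrite -Zp_intr_eq0 // rmorphD rmorphXn /= -!pmulrn natr_Zp natrX.
  by rewrite DE addNr.
split; split=> //.
have [d' cd' nE'] := pfactor_coprime (isT : prime 2) (ltn_addl n (ltn0Sn 0)).
move: cd' nE'; rewrite coprime2n; move: (logn 2 (n + 1)) => s' od' nE'.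
(* As 4 divides n + 1, the index r = 1 is admissible, and 2 d' is 2 modulo 4. *)
have s'1 : (1 < s')%N.
  by case: s' nE' => [|[|s']] //; rewrite ?expn0 ?expn1; lia.
exists d', s'; split=> //; right; exists 1%N => //.
have -> : (d' * 2 ^ 1 = 4 * d'./2 + 2)%N by lia.
exact: lucasV_mul4_add2.
Qed.
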